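(* Let $A$ be a real symmetric $n\times n$ matrix and $i\in[n]$. If $A$ has the $i$-SNIP, then both $A$ and $A(i)$ have the SAP.
   Context: $A(i)$ is $A$ with row and column $i$ deleted. A symmetric matrix $M$ has the strong Arnold property (SAP) if $X=O$ is the only real symmetric $X$ with $M\circ X=O$, $I\circ X=O$ and $MX=O$ ($\circ$ the entrywise product). $A$ has the $i$-SNIP if $X=O$ is the only real symmetric $X$ with $A\circ X=O$, $I\circ X=O$ and $(AX)(i,:]=O$, where $(AX)(i,:]$ is $AX$ with row $i$ deleted. *)

(* Defs.v *)
From mathcomp Require Import all_boot all_order all_algebra.
From mathcomp Require Import reals.

Set Implicit Arguments.
Unset Strict Implicit.
Unset Printing Implicit Defensive.

Import GRing.Theory.
Local Open Scope ring_scope.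

Definition hadamard (R : realType) (m n : nat) (A B : 'M[R]_(m, n)) :
  'M[R]_(m, n) := map2_mx *%R A B.

(* A(i) *)
Definition del_rc (R : realType) (n : nat) (i : 'I_n) (A : 'M[R]_n) :
  'M[R]_n.-1 := row' i (col' i A).

(* Strong Arnold property; intended for symmetric M. *)
Definition SAP (R : realType) (n : nat) (M : 'M[R]_n) : Prop :=
  forall X : 'M[R]_n,
    X^T = X -> hadamard M X = 0 -> hadamard 1%:M X = 0 -> M *m X = 0 ->
    X = 0.

(* i-SNIP; intended for symmetric A. *)
Definition SNIP (R : realType) (n : nat) (i : 'I_n) (A : 'M[R]_n) : Prop :=
  forall X : 'M[R]_n,
    X^T = X -> hadamard A X = 0 -> hadamard 1%:M X = 0 ->
    row' i (A *m X) = 0 ->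
    X = 0.

(* Main.v *)
Require Import Defs.
From mathcomp Require Import all_boot all_order all_algebra.
From mathcomp Require Import reals.

Set Implicit Arguments.
Unset Strict Implicit.
Unset Printing Implicit Defensive.

Import GRing.Theory.
Local Open Scope ring_scope.

(** The i-SNIP asks that fewer constraints on [X] already force [X = 0], so it implies the SAP of
    [A]. For [A(i)], a test matrix [X] is enlarged to [zero_border i X] by a zero row and column at
    position [i]. This keeps symmetry and the entrywise conditions ([hadamard_zero_border]), and the
    rows of the product with [A] other than row [i] come from [A(i) X] ([row'_mul_zero_border]). Row
    [i] is uncontrolled, but it is exactly the row that the i-SNIP ignores. *)

Definition zero_border (R : realType) (n : nat) (i : 'I_n) (X : 'M[R]_n.-1) :
    'M[R]_n :=
  \matrix_(a, b)
    if unlift i a is Some p then if unlift i b is Some q then X p q else 0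
    else 0.

Lemma zero_border_liftE (R : realType) (n : nat) (i : 'I_n) (X : 'M[R]_n.-1)
  p q : zero_border i X (lift i p) (lift i q) = X p q.
Proof. by rewrite mxE !liftK. Qed.

Lemma zero_border_row (R : realType) (n : nat) (i : 'I_n) (X : 'M[R]_n.-1) b :
  zero_border i X i b = 0.
Proof. by rewrite mxE unlift_none. Qed.

Lemma zero_border_col (R : realType) (n : nat) (i : 'I_n) (X : 'M[R]_n.-1) a :
  zero_border i X a i = 0.
Proof. by rewrite mxE unlift_none; case: unlift. Qed.

Lemma trmx_zero_border (R : realType) (n : nat) (i : 'I_n) (X : 'M[R]_n.-1) :
  (zero_border i X)^T = zero_border i X^T.
Proof.
apply/matrixP=> a b; rewrite !mxE.
by case: (unlift i a) => [p|]; case: (unlift i b) => [q|]; rewrite ?mxE.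
Qed.

(** The zero border absorbs whatever row and column [i] of [A] contain. Taking [1%:M] for [A] also
    handles the diagonal condition, via [del_rc1]. *)
Lemma hadamard_zero_border (R : realType) (n : nat) (i : 'I_n) (A : 'M[R]_n)
    (X : 'M[R]_n.-1) :
  hadamard A (zero_border i X) =
  zero_border i (hadamard (del_rc i A) X).
Proof.
apply/matrixP=> a b; rewrite !mxE.
case: (unliftP i a) => [p ->|_]; last by rewrite mulr0.
case: (unliftP i b) => [q ->|_]; last by rewrite mulr0.
by rewrite !mxE.
Qed.

(** The zero row [i] of the bordered matrix cancels column [i] of [A], so away from row [i] only
    entries of [A(i)] contribute. Row [i] must be dropped: there the product holds row [i] of [A]
    times [X], which need not vanish. *)
Lemma row'_mul_zero_border (R : realType) (n : nat) (i : 'I_n) (A : 'M[R]_n)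
    (X : 'M[R]_n.-1) :
  row' i (A *m zero_border i X) =
  row' i (zero_border i (del_rc i A *m X)).
Proof.
(* ['I_0] is empty; a successor size lets [bigD1_ord] split the term at [i] off the sum. *)
case: n i A X => [[]//|n] i A X.
apply/matrixP=> p b; rewrite mxE [RHS]mxE mxE (bigD1_ord i) //=.
rewrite zero_border_row mulr0 add0r.
case: (unliftP i b) => [q ->|->].
  rewrite zero_border_liftE mxE; apply: eq_bigr => k _.
  by rewrite zero_border_liftE !mxE.
by rewrite zero_border_col big1 // => k _; rewrite zero_border_col mulr0.
Qed.

Lemma zero_border0 (R : realType) (n : nat) (i : 'I_n) :
  zero_border i (0 : 'M[R]_n.-1) = 0.
Proof.
by apply/matrixP=> a b; rewrite !mxE; do 2?case: unlift => [?|//]; rewrite mxE.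
Qed.

Lemma del_rc1 (R : realType) (n : nat) (i : 'I_n) :
  del_rc i (1%:M : 'M[R]_n) = 1%:M.
Proof. by apply/matrixP=> p q; rewrite !mxE (inj_eq lift_inj). Qed.

(** If all of [A *m X] vanishes, so do its rows other than [i]. *)
Lemma SNIP_SAP (R : realType) (n : nat) (i : 'I_n) (A : 'M[R]_n) :
  SNIP i A -> SAP A.
Proof.
move=> snipA X symX AX0 IX0 mulAX0; apply: snipA => //.
by rewrite mulAX0; apply/matrixP=> p q; rewrite !mxE.
Qed.

Lemma SNIP_SAP_del_rc (R : realType) (n : nat) (i : 'I_n) (A : 'M[R]_n) :
  SNIP i A -> SAP (del_rc i A).
Proof.
move=> snipA X symX AX0 IX0 mulAX0.
(* [X] survives as the block away from [i], so it suffices to apply the i-SNIP to the bordered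
   matrix. *)
suff Y0 : zero_border i X = 0.
  by apply/matrixP=> p q; rewrite -(zero_border_liftE i) Y0 !mxE.
apply: snipA.
- by rewrite trmx_zero_border symX.
- by rewrite hadamard_zero_border AX0 zero_border0.
- by rewrite hadamard_zero_border del_rc1 IX0 zero_border0.
- rewrite row'_mul_zero_border mulAX0 zero_border0.
  by apply/matrixP=> p q; rewrite !mxE.
Qed.

Theorem lemma3p6 (R : realType) (n : nat) (A : 'M[R]_n) (i : 'I_n)
  (symA : A^T = A) (snipA : SNIP i A) :
  SAP A /\ SAP (del_rc i A).
Proof. by split; [apply: SNIP_SAP snipA | apply: SNIP_SAP_del_rc]. Qed.
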